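(* Let $\mathfrak{M}=\mathfrak{M}_1\dotplus\mathfrak{M}_2$ be a splitting $3$-dimensional Lie triple system over $\mathbb{R}$, where $\mathfrak{M}_1\cong\mathbb{R}$ is a one-dimensional solvable ideal of $\mathfrak{M}$ and $\mathfrak{M}_2$ is a $2$-dimensional simple Lie triple system. For a basis $(e_1,e_2,e_3)$ of $\mathfrak{M}$ with $\mathfrak{M}_1=\langle e_1\rangle$ and $\mathfrak{M}_2=\langle e_2,e_3\rangle$ consider the linear maps $A=(e_1,e_2,-)$, $B=(e_2,e_3,-)$, $C=(e_3,e_1,-)$ from $\mathfrak{M}$ to $\mathfrak{M}$. Then, up to isomorphism (with a suitable choice of such a basis), the following situations are the possible ones, each of them occurs, and systems of different types are non-isomorphic: Type 1. $\mathfrak{M}=\mathbb{R}\oplus\mathfrak{M}_2$ is the direct sum of a one-dimensional Abelian ideal and a $2$-dimensional simple ideal $\mathfrak{M}_2$, where $\mathfrak{M}_2$ is a simple $2$-dimensional Lie triple system of the form $so(3)/so(2)$, $sl(2,\mathbb{R})/so(2)$ or $sl(2,\mathbb{R})/\mathbb{R}$. Type 2. $A=\begin{pmatrix}0&-1&0\\0&0&0\\0&0&0\end{pmatrix}$, $B=\begin{pmatrix}0&0&0\\0&0&-1\\0&1&0\end{pmatrix}$, $C=\begin{pmatrix}0&0&1\\0&0&0\\0&0&0\end{pmatrix}$; $\mathfrak{M}_2$ is of the form $so(3)/so(2)$. Type 3. $A=\begin{pmatrix}0&1&0\\0&0&0\\0&0&0\end{pmatrix}$, $B=\begin{pmatrix}0&0&0\\0&0&1\\0&-1&0\end{pmatrix}$,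 $C=\begin{pmatrix}0&0&-1\\0&0&0\\0&0&0\end{pmatrix}$; $\mathfrak{M}_2$ is of the form $sl(2,\mathbb{R})/so(2)$. Type 4. $A=\begin{pmatrix}0&-1&0\\0&0&0\\0&0&0\end{pmatrix}$, $B=\begin{pmatrix}0&0&0\\0&0&1\\0&1&0\end{pmatrix}$, $C=\begin{pmatrix}0&0&-1\\0&0&0\\0&0&0\end{pmatrix}$; $\mathfrak{M}_2$ is of the form $sl(2,\mathbb{R})/\mathbb{R}$. Type 5. $A=-C=\begin{pmatrix}0&-\frac14&\frac14\\0&0&0\\0&0&0\end{pmatrix}$, $B=\begin{pmatrix}-\frac12&0&0\\0&0&1\\0&1&0\end{pmatrix}$; $\mathfrak{M}_2$ is of the form $sl(2,\mathbb{R})/\mathbb{R}$. Type 6. $A=C=\begin{pmatrix}0&-\frac14&-\frac14\\0&0&0\\0&0&0\end{pmatrix}$, $B=\begin{pmatrix}\frac12&0&0\\0&0&1\\0&1&0\end{pmatrix}$; $\mathfrak{M}_2$ is of the form $sl(2,\mathbb{R})/\mathbb{R}$.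
   Context: A Lie triple system is a finite-dimensional real vector space $\mathfrak{M}$ with a trilinear operation $(x,y,z)$ satisfying $(x,x,y)=0$, $(x,y,z)+(y,z,x)+(z,x,y)=0$, and $(x,y,(u,v,w))=((x,y,u),v,w)+(u,(x,y,v),w)+(u,v,(x,y,w))$ for all elements. It is Abelian if the operation is identically zero. A subspace $\mathfrak{D}$ is a subsystem if $(\mathfrak{D},\mathfrak{D},\mathfrak{D})\subset\mathfrak{D}$ and an ideal if $(\mathfrak{D},\mathfrak{M},\mathfrak{M})\subset\mathfrak{D}$. Isomorphisms are linear bijections preserving the trilinear operation. An ideal $\Omega$ of $\mathfrak{M}$ is solvable if $\Omega^{(k)}=0$ for some $k$, where $\Omega^{(1)}=(\mathfrak{M},\Omega,\Omega)$ and $\Omega^{(k)}=(\mathfrak{M},\Omega^{(k-1)},\Omega^{(k-1)})$ (linear spans). A Lie triple system is semisimple if its maximal solvable ideal is zero; simple means non-Abelian with no proper nonzero ideals. A $3$-dimensional Lie triple system is called splitting if $\mathfrak{M}=\mathfrak{M}_1\dotplus\mathfrak{M}_2$ (direct sum of vector spaces) with $\mathfrak{M}_1$ a one-dimensional solvable ideal and $\mathfrak{M}_2$ a two-dimensional subsystem that is a simple (semisimple) Lie triple system. Two-dimensional systems: a two-dimensional Lie triple system can be written as $(X,Y,Z)=\beta(X,Z)Y-\beta(Y,Z)X$ with $\beta$ a symmetric bilinear form. In a suitable basis, the system is said to be of the form $so(3)/so(2)$ if $\beta=\mathrm{diag}(1,1)$, $sl(2,\mathbb{R})/so(2)$ if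 $\beta=\mathrm{diag}(-1,-1)$, and $sl(2,\mathbb{R})/\mathbb{R}$ if $\beta=\mathrm{diag}(1,-1)$. Matrix convention: the $j$-th column of the matrix of a linear map gives the coordinates of the image of $e_j$ in the basis $e_1,e_2,e_3$. $\langle\cdots\rangle$ denotes linear span.
   Formalization: ''Systems of different types are non-isomorphic'' fails for Types 5 and 6: replacing e3 by -e3 turns the Type 5 matrices into those of Type 6. Non-isomorphism is stated for all other pairs of types, and any Type 5 system is stated to be isomorphic to any Type 6 system. *)

(* Defs.v *)
From HB Require Import structures.
From mathcomp Require Import all_boot all_order all_algebra reals.

Set Implicit Arguments.
Unset Strict Implicit.
Unset Printing Implicit Defensive.

Import Order.TTheory GRing.Theory Num.Theory.
Local Open Scope ring_scope.

(* A finite-dimensional space is a vectType.  Subsystems and ideals are vector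
   subspaces {vspace V} of the ambient system, and the properties of a
   subsystem S (ideal, abelian, simple) are relative to S, the whole system
   being fullv. *)

Section LieTripleSystem.
Variables (R : realType) (V : vectType R).

Definition trilinear (t : V -> V -> V -> V) : Prop :=
  [/\ forall y z, linear (fun x => t x y z),
      forall x z, linear (fun y => t x y z)
    & forall x y, linear (fun z => t x y z)].

Record lts : Type := Lts {
  lts_op :> V -> V -> V -> V;
  lts_trilinear : trilinear lts_op;
  lts_alt : forall x y, lts_op x x y = 0;
  lts_cyclic : forall x y z, lts_op x y z + lts_op y z x + lts_op z x y = 0;
  lts_derivation : forall x y u v w,
    lts_op x y (lts_op u v w) =
      lts_op (lts_op x y u) v w + lts_op u (lts_op x y v) w
        + lts_op u v (lts_op x y w)
}.

Variable M : lts.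
Implicit Types A B C D S W : {vspace V}.

(* The linear span of all M x y z with x in A, y in B and z in C. *)
Definition triplev A B C : {vspace V} :=
  <<[seq M p.1 p.2 z | p <- [seq (x, y) | x <- vbasis A, y <- vbasis B],
                       z <- vbasis C]>>%VS.

Definition subsystem S : Prop := (triplev S S S <= S)%VS.

Definition ideal S D : Prop := (D <= S)%VS /\ (triplev D S S <= D)%VS.

Definition abelian S : Prop :=
  forall x y z, x \in S -> y \in S -> z \in S -> M x y z = 0.

Definition simple S : Prop :=
  ~ abelian S /\ forall D, ideal S D -> D = 0%VS \/ D = S.

(* derived D k is the k-th term D^(k); here D^(0) = D. *)
Definition derived D (k : nat) : {vspace V} :=
  iter k (fun W => triplev fullv W W) D.

Definition solvable D : Prop := exists k, derived D k.+1 = 0%VS.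

Definition splitting (M1 M2 : {vspace V}) : Prop :=
  [/\ [/\ \dim {:V} = 3%N, (M1 + M2)%VS = fullv & directv (M1 + M2)],
      [/\ \dim M1 = 1%N, ideal fullv M1 & solvable M1]
    & [/\ \dim M2 = 2%N, subsystem M2 & simple M2]].

End LieTripleSystem.

Definition lts_iso (R : realType) (V W : vectType R)
    (M : lts V) (N : lts W) : Prop :=
  exists f : 'Hom(V, W),
    bijective f /\ forall x y z, f (M x y z) = N (f x) (f y) (f z).

Inductive form2 := SO3_SO2 | SL2_SO2 | SL2_R.

Section SplittingTypes.
Variables (R : realType) (V : vectType R) (M : lts V).

Definition mx_of_rows (n : nat) (rows : seq (seq R)) : 'M[R]_n :=
  \matrix_(i, j) (nth [::] rows i)`_j.

Definition form2_mx (f : form2) : 'M[R]_2 :=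
  match f with
  | SO3_SO2 => mx_of_rows 2 [:: [:: 1; 0]; [:: 0; 1]]
  | SL2_SO2 => mx_of_rows 2 [:: [:: -1; 0]; [:: 0; -1]]
  | SL2_R => mx_of_rows 2 [:: [:: 1; 0]; [:: 0; -1]]
  end.

(* The bilinear form, on the span of e, with Gram matrix G in the basis e. *)
Definition gram_form (e : 2.-tuple V) (G : 'M[R]_2) (x y : V) : R :=
  \sum_i \sum_j coord e i x * G i j * coord e j y.

Definition of_form2 (f : form2) (S : {vspace V}) : Prop :=
  exists e : 2.-tuple V, basis_of S e /\
    let beta := gram_form e (form2_mx f) in
    forall x y z, x \in S -> y \in S -> z \in S ->
      M x y z = beta x z *: y - beta y z *: x.

Definition has_matrix (e : 3.-tuple V) (f : V -> V) (A : 'M[R]_3) : Prop :=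
  forall j, f (tnth e j) = \sum_i A i j *: tnth e i.

Definition has_matrices (M1 M2 : {vspace V}) (A B C : 'M[R]_3) : Prop :=
  exists e1 e2 e3 : V, let e := [tuple e1; e2; e3] in
    [/\ basis_of fullv e, M1 = <[e1]>%VS & M2 = <<[:: e2; e3]>>%VS] /\
    [/\ has_matrix e (M e1 e2) A, has_matrix e (M e2 e3) B
      & has_matrix e (M e3 e1) C].

Inductive splitType := Ty1 | Ty2 | Ty3 | Ty4 | Ty5 | Ty6.

Definition has_type (k : splitType) (M1 M2 : {vspace V}) : Prop :=
  match k with
  | Ty1 =>
      [/\ ideal M fullv M1, abelian M M1, ideal M fullv M2, simple M M2
        & exists f, of_form2 f M2]
  | Ty2 =>
      has_matrices M1 M2
        (mx_of_rows 3 [:: [:: 0; -1; 0]; [:: 0; 0; 0]; [:: 0; 0; 0]])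
        (mx_of_rows 3 [:: [:: 0; 0; 0]; [:: 0; 0; -1]; [:: 0; 1; 0]])
        (mx_of_rows 3 [:: [:: 0; 0; 1]; [:: 0; 0; 0]; [:: 0; 0; 0]])
      /\ of_form2 SO3_SO2 M2
  | Ty3 =>
      has_matrices M1 M2
        (mx_of_rows 3 [:: [:: 0; 1; 0]; [:: 0; 0; 0]; [:: 0; 0; 0]])
        (mx_of_rows 3 [:: [:: 0; 0; 0]; [:: 0; 0; 1]; [:: 0; -1; 0]])
        (mx_of_rows 3 [:: [:: 0; 0; -1]; [:: 0; 0; 0]; [:: 0; 0; 0]])
      /\ of_form2 SL2_SO2 M2
  | Ty4 =>
      has_matrices M1 M2
        (mx_of_rows 3 [:: [:: 0; -1; 0]; [:: 0; 0; 0]; [:: 0; 0; 0]])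
        (mx_of_rows 3 [:: [:: 0; 0; 0]; [:: 0; 0; 1]; [:: 0; 1; 0]])
        (mx_of_rows 3 [:: [:: 0; 0; -1]; [:: 0; 0; 0]; [:: 0; 0; 0]])
      /\ of_form2 SL2_R M2
  | Ty5 =>
      has_matrices M1 M2
        (mx_of_rows 3 [:: [:: 0; - 4^-1; 4^-1]; [:: 0; 0; 0]; [:: 0; 0; 0]])
        (mx_of_rows 3 [:: [:: - 2^-1; 0; 0]; [:: 0; 0; 1]; [:: 0; 1; 0]])
        (mx_of_rows 3 [:: [:: 0; 4^-1; - 4^-1]; [:: 0; 0; 0]; [:: 0; 0; 0]])
      /\ of_form2 SL2_R M2
  | Ty6 =>
      has_matrices M1 M2
        (mx_of_rows 3 [:: [:: 0; - 4^-1; - 4^-1]; [:: 0; 0; 0]; [:: 0; 0; 0]])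
        (mx_of_rows 3 [:: [:: 2^-1; 0; 0]; [:: 0; 0; 1]; [:: 0; 1; 0]])
        (mx_of_rows 3 [:: [:: 0; - 4^-1; - 4^-1]; [:: 0; 0; 0]; [:: 0; 0; 0]])
      /\ of_form2 SL2_R M2
  end.

End SplittingTypes.

Section TripleTheory.
Variables (R : realType) (V : vectType R) (M : lts V).

Lemma triplevP (A B C D : {vspace V}) :
  (triplev M A B C <= D)%VS <->
  (forall x y z, x \in A -> y \in B -> z \in C -> M x y z \in D).
Proof.
case: (lts_trilinear M) => l1 l2 l3.
have s0 (h : V -> V) : linear h -> h 0 = 0.
  by move=> hl; have := hl (-1) 0 0; rewrite !scaleN1r !addNr.
have sum_in (h : V -> V) (U : {vspace V}) : linear h ->
    (forall u, u \in (vbasis U : seq V) -> h u \in D) ->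
    forall u, u \in U -> h u \in D.
  move=> hl hD u /coord_vbasis ->.
  apply: (big_ind (fun v => h v \in D)); first by rewrite (s0 h hl) mem0v.
    by move=> v w hv hw; have := hl 1 v w; rewrite !scale1r => ->; rewrite memvD.
  move=> i _; have -> : h (coord (vbasis U) i u *: (vbasis U)`_i) =
      coord (vbasis U) i u *: h (vbasis U)`_i.
    by have := hl (coord (vbasis U) i u) (vbasis U)`_i 0; rewrite (s0 h hl) !addr0.
  apply/memvZ/hD/mem_nth.
  by rewrite size_tuple.
split=> [/span_subvP sD x y z xA yB zC | sD].
  apply: (sum_in (fun x => M x y z) A) xA => // u uA.
  apply: (sum_in (fun y => M u y z) B) yB => // v vB.
  apply: (sum_in (fun z => M u v z) C) zC => // w wC.
  apply/sD/allpairsP; exists ((u, v), w); split=> //=.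
  by apply/allpairsP; exists (u, v).
apply/span_subvP=> _ /allpairsP[[p z] /= [/allpairsP[q [qA qB ->]] zC ->]].
by apply: sD; apply: vbasis_mem.
Qed.

Lemma ltsN (x y z : V) : (M x (- y) z = - M x y z) * (M x y (- z) = - M x y z)
  * (M (- x) y z = - M x y z) * (M y x z = - M x y z).
Proof.
case: (lts_trilinear M) => l1 l2 l3.
have sN (h : V -> V) : linear h -> forall v, h (- v) = - h v.
  move=> hl v; have h0 : h 0 = 0.
    by have := hl (-1) 0 0; rewrite !scaleN1r !addNr.
  by have := hl (-1) v 0; rewrite h0 !addr0 !scaleN1r.
have sD (h : V -> V) : linear h -> {morph h : u v / u + v}.
  by move=> hl u v; have := hl 1 u v; rewrite !scale1r.
rewrite (sN (fun y => M x y z)) // (sN (fun z => M x y z)) //.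
rewrite (sN (fun x => M x y z)) //; do !split=> //.
have := lts_alt M (x + y) z.
rewrite (sD (fun x' => M x' (x + y) z)) // (sD (fun y' => M x y' z)) //.
rewrite (sD (fun y' => M y y' z)) // !lts_alt add0r addr0.
by move/eqP; rewrite addrC addr_eq0 => /eqP.
Qed.

(* Replacing e3 by - e3 exchanges the matrices of Ty5 and Ty6. *)
Lemma has_type56 (M1 M2 : {vspace V}) :
  has_type M Ty5 M1 M2 <-> has_type M Ty6 M1 M2.
Proof.
have spanN (a b c : V) :
    (<<[:: a; b; - c]>> = <<[:: a; b; c]>>)%VS.
  rewrite !span_cons !span_nil; congr (_ + (_ + (_ + _)))%VS.
  by apply/vspaceP => v; apply/vlineP/vlineP=> -[k ->]; exists (- k);
     rewrite ?scaleNr ?scalerN ?opprK.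
have spanN2 (a b : V) : (<<[:: a; - b]>> = <<[:: a; b]>>)%VS.
  rewrite !span_cons !span_nil; congr (_ + (_ + _))%VS.
  by apply/vspaceP => v; apply/vlineP/vlineP=> -[k ->]; exists (- k);
     rewrite ?scaleNr ?scalerN ?opprK.
have basN (a b c : V) :
    basis_of fullv [:: a; b; c] -> basis_of fullv [:: a; b; - c].
  by rewrite !basisEdim spanN.
have mxP e1 e2 e3 (h : V -> V) (rows : seq (seq R)) :
    has_matrix [tuple e1; e2; e3] h (mx_of_rows 3 rows) <->
    let r (i j : nat) := (nth [::] rows i)`_j in
    let c j := r 0%N j *: e1 + r 1%N j *: e2 + r 2%N j *: e3 in
    [/\ h e1 = c 0%N, h e2 = c 1%N & h e3 = c 2%N].
  split=> [hh|[h0 h1 h2] j]; last first.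
    rewrite !big_ord_recl big_ord0 !mxE !(tnth_nth 0) /= addr0 addrA.
    by case: j => [[|[|[|?]]]].
  have H j := hh (inord j); split.
  - by have := H 0; rewrite !big_ord_recl big_ord0 !mxE !(tnth_nth 0) /= !inordK //= addr0 addrA.
  - by have := H 1; rewrite !big_ord_recl big_ord0 !mxE !(tnth_nth 0) /= !inordK //= addr0 addrA.
  - by have := H 2; rewrite !big_ord_recl big_ord0 !mxE !(tnth_nth 0) /= !inordK //= addr0 addrA.
have N1 x y z : M (- x) y z = - M x y z by rewrite ltsN.
have N2 x y z : M x (- y) z = - M x y z by rewrite ltsN.
have N3 x y z : M x y (- z) = - M x y z by rewrite ltsN.
split=> -[[e1 [e2 [e3 [[eb e1M e23M] [/mxP hA /mxP hB /mxP hC]]]]] f].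
all: split=> //; exists e1, e2, (- e3).
all: move: hA hB hC => /= [A1 A2 A3] [B1 B2 B3] [C1 C2 C3].
all: split; first by split; [exact: basN | | rewrite spanN2].
all: split; apply/mxP; split=> /=.
all: by rewrite ?(N1, N2, N3) ?(A1, A2, A3, B1, B2, B3, C1, C2, C3)
        ?(scale0r, scale1r, scaleNr, scalerN, addr0, add0r, opprK, oppr0).
Qed.

End TripleTheory.

(* Main.v *)
(* Write beta = diag(p, q) with p, q = 1 or -1 for the form of M2, in a basis
   (e2, e3) of M2.  Solvability of M1 = <e1> gives (e1, x, e1) = 0, so that the
   operation is determined by beta and by the bilinear form sigma on M2 with
   (e1, x, y) = sigma(x, y) e1.  Since (e2, e3, -) is a derivation acting on e1
   by a scalar, it is skew for sigma, hence sigma = s beta + t omega with omega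
   the area form; the remaining derivation identities become t (1 + 4 s) = 0
   and s (1 + s) p q = 3 t^2.  The solutions s = t = 0; s = -1, t = 0; and
   s = -1/4, t = 1/4 or -1/4, p q = -1 are the listed types.  They are separated
   by the existence of v <> 0 with (v, x, y) = 0 for all x, y (Type 1), the
   existence of v <> 0 with (x, y, v) = 0 for all x, y (Types 1 to 4), and the
   eps = 1, -1 for which (x, y, x) = eps y has a solution with y <> 0 (the signs
   of beta). *)

Require Import Defs.
From HB Require Import structures.
From mathcomp Require Import all_boot all_order all_algebra reals.
From mathcomp Require Import ring lra.

Set Implicit Arguments.
Unset Strict Implicit.
Unset Printing Implicit Defensive.

Import Order.TTheory GRing.Theory Num.Theory.
Local Open Scope ring_scope.

(** * Coordinates with respect to two or three vectors *)

Section LinearCombinations.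
Variables (R : realType) (V : vectType R).
Implicit Types (u v e : V) (a b c : R).

Definition lc2 u v a b : V := a *: u + b *: v.

Definition lc3 e1 e2 e3 a b c : V := a *: e1 + b *: e2 + c *: e3.

Lemma lc2D u v a b a' b' : lc2 u v a b + lc2 u v a' b' = lc2 u v (a + a') (b + b').
Proof. by rewrite /lc2 !scalerDl addrACA. Qed.

Lemma lc2Z u v k a b : k *: lc2 u v a b = lc2 u v (k * a) (k * b).
Proof. by rewrite /lc2 scalerDr !scalerA. Qed.

Lemma lc2N u v a b : - lc2 u v a b = lc2 u v (- a) (- b).
Proof. by rewrite /lc2 opprD !scaleNr. Qed.

Lemma lc2_10 u v : lc2 u v 1 0 = u.
Proof. by rewrite /lc2 scale1r scale0r addr0. Qed.

Lemma lc2_01 u v : lc2 u v 0 1 = v.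
Proof. by rewrite /lc2 scale1r scale0r add0r. Qed.

Definition lc2E := (lc2D, lc2Z, lc2N).

Lemma lc3D e1 e2 e3 a b c a' b' c' :
  lc3 e1 e2 e3 a b c + lc3 e1 e2 e3 a' b' c' =
  lc3 e1 e2 e3 (a + a') (b + b') (c + c').
Proof. by rewrite /lc3 !scalerDl addrACA (addrACA (a *: e1)). Qed.

Lemma lc3Z e1 e2 e3 k a b c :
  k *: lc3 e1 e2 e3 a b c = lc3 e1 e2 e3 (k * a) (k * b) (k * c).
Proof. by rewrite /lc3 !scalerDr !scalerA. Qed.

Lemma lc3N e1 e2 e3 a b c : - lc3 e1 e2 e3 a b c = lc3 e1 e2 e3 (- a) (- b) (- c).
Proof. by rewrite /lc3 !opprD !scaleNr. Qed.

Lemma lc3_000 e1 e2 e3 : lc3 e1 e2 e3 0 0 0 = 0.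
Proof. by rewrite /lc3 !scale0r !addr0. Qed.

Lemma lc3_100 e1 e2 e3 : lc3 e1 e2 e3 1 0 0 = e1.
Proof. by rewrite /lc3 !scale0r !addr0 scale1r. Qed.

Lemma lc3_010 e1 e2 e3 : lc3 e1 e2 e3 0 1 0 = e2.
Proof. by rewrite /lc3 !scale0r addr0 add0r scale1r. Qed.

Lemma lc3_001 e1 e2 e3 : lc3 e1 e2 e3 0 0 1 = e3.
Proof. by rewrite /lc3 !scale0r !add0r scale1r. Qed.

Definition lc3E := (lc3D, lc3Z, lc3N).

Lemma mem_span2P u v x :
  reflect (exists a b, x = lc2 u v a b) (x \in <<[:: u; v]>>%VS).
Proof.
rewrite span_cons span_seq1; apply: (iffP memv_addP) => [|[a [b ->]]].
  by case=> _ /vlineP[a ->] [_ /vlineP[b ->] ->]; exists a, b.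
by exists (a *: u); rewrite ?memvZ ?memv_line //; exists (b *: v);
   rewrite ?memvZ ?memv_line.
Qed.

Lemma mem_basis2 (S : {vspace V}) u v x :
  basis_of S [:: u; v] -> x \in S -> exists a b, x = lc2 u v a b.
Proof. by move/span_basis => <- /mem_span2P. Qed.

Lemma basis2_mem (S : {vspace V}) u v :
  basis_of S [:: u; v] -> u \in S /\ v \in S.
Proof. by move=> B; split; apply: (basis_mem B); rewrite !inE eqxx ?orbT. Qed.

Lemma basis3P e1 e2 e3 x :
  basis_of fullv [:: e1; e2; e3] -> exists a b c, x = lc3 e1 e2 e3 a b c.
Proof.
move=> /span_basis; rewrite span_cons => fE; have := memvf x; rewrite -fE.
case/memv_addP=> _ /vlineP[a ->] [_ /mem_span2P[b [c ->]] ->].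
by exists a, b, c; rewrite /lc3 -addrA.
Qed.

Lemma lc3_inj e1 e2 e3 a b c a' b' c' : free [:: e1; e2; e3] ->
  lc3 e1 e2 e3 a b c = lc3 e1 e2 e3 a' b' c' -> [/\ a = a', b = b' & c = c'].
Proof.
move=> F /eqP; rewrite -subr_eq0 !lc3E => /eqP E.
have /freeP/(_ (fun i : 'I_3 => [:: a - a'; b - b'; c - c']`_i)) :
  free [tuple e1; e2; e3] by [].
rewrite !big_ord_recl big_ord0 /= addr0 addrA => /(_ E) H.
by split; apply/eqP; rewrite -subr_eq0; apply/eqP;
   [exact: (H 0)|exact: (H 1)|have := H (inord 2); rewrite inordK].
Qed.

Lemma basis2_change (S : {vspace V}) u v k l m n :
  basis_of S [:: u; v] -> k * n - l * m != 0 ->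
  basis_of S [:: lc2 u v k l; lc2 u v m n].
Proof.
move=> B d0; set d := _ - _ in d0.
rewrite basisEdim (@size_basis _ _ _ 2 [tuple u; v] B) leqnn andbT.
apply/subvP=> x /(mem_basis2 B)[a [b ->]]; apply/mem_span2P.
(* Cramer's rule for the coordinates in the new pair, whose determinant is [d]. *)
exists ((a * n - b * m) / d), ((b * k - a * l) / d); rewrite /(lc2 (lc2 _ _ _ _)) !lc2E.
by congr lc2; rewrite /d; field.
Qed.

End LinearCombinations.

(** * Multilinear expansion of the triple product *)

Section Expansion.
Variables (R : realType) (V : vectType R) (M : lts V).
Implicit Types (u v x y z e : V).

Lemma ltsD : (forall x x' y z, M (x + x') y z = M x y z + M x' y z) *
  (forall x y y' z, M x (y + y') z = M x y z + M x y' z) *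
  (forall x y z z', M x y (z + z') = M x y z + M x y z').
Proof.
have [l1 l2 l3] := lts_trilinear M.
have D (h : V -> V) : linear h -> {morph h : u v / u + v}.
  by move=> hl u v; have := hl 1 u v; rewrite !scale1r.
split; [split|] => *; [exact: D (l1 _ _) _ _|exact: D (l2 _ _) _ _|].
exact: D (l3 _ _) _ _.
Qed.

Lemma ltsZ : (forall k x y z, M (k *: x) y z = k *: M x y z) *
  (forall k x y z, M x (k *: y) z = k *: M x y z) *
  (forall k x y z, M x y (k *: z) = k *: M x y z).
Proof.
have [l1 l2 l3] := lts_trilinear M.
have Z (h : V -> V) : linear h -> forall k x, h (k *: x) = k *: h x.
  move=> hl k x; have h0 : h 0 = 0 by have := hl (-1) 0 0; rewrite !scaleN1r !addNr.
  by rewrite -[k *: x]addr0 hl h0 addr0.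
split; [split|] => k x y z; [exact: Z (l1 y z) _ _|exact: Z (l2 x z) _ _|].
exact: Z (l3 x y) _ _.
Qed.

Lemma lts_antisym x y z : M y x z = - M x y z.
Proof. by rewrite ltsN. Qed.

Lemma lts_lc2 u v (x1 x2 y1 y2 : R) z :
  M (lc2 u v x1 x2) (lc2 u v y1 y2) z = (x1 * y2 - x2 * y1) *: M u v z.
Proof.
rewrite /lc2 !ltsD !ltsZ !lts_alt (lts_antisym u v) !scaler0 !scalerN !scalerA.
by rewrite add0r addr0 -scaleNr -scalerDl addrC mulrC (mulrC y1).
Qed.

Lemma lts_lc3 e1 e2 e3 (x1 x2 x3 y1 y2 y3 : R) z :
  M (lc3 e1 e2 e3 x1 x2 x3) (lc3 e1 e2 e3 y1 y2 y3) z =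
  lc3 (M e1 e2 z) (M e1 e3 z) (M e2 e3 z)
    (x1 * y2 - x2 * y1) (x1 * y3 - x3 * y1) (x2 * y3 - x3 * y2).
Proof.
rewrite {1 2}/lc3 !ltsD !ltsZ !lts_alt.
rewrite (lts_antisym e1 e2) (lts_antisym e1 e3) (lts_antisym e2 e3).
rewrite !scaler0.
move: (M e1 e2 z) (M e1 e3 z) (M e2 e3 z) => p q r.
(* With [lc3 p q r] generalized to [L], the backward rewrites turn 0, [p], [q], [r] into values of
   [L]. Both sides then collect into a single [L], and [ring] compares coefficients. *)
move: (lc3D p q r) (lc3Z p q r) (lc3N p q r) (lc3_000 p q r) (lc3_100 p q r)
  (lc3_010 p q r) (lc3_001 p q r).
move: (lc3 p q r) => L LD LZ LN <- <- <- <-.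
rewrite !(LD, LZ, LN).
by congr L; ring.
Qed.

End Expansion.

(** * Two-dimensional subsystems and their symmetric forms *)

Section Gram.
Variables (R : realType) (V : vectType R) (M : lts V).
Implicit Types (u v x y z e : V) (a b c : R) (S : {vspace V}).

(* On <u, v> the operation is beta(x, z) y - beta(y, z) x, where beta has
   Gram matrix [[a, b], [b, c]] in (u, v). *)
Definition gram u v a b c : Prop :=
  M u v u = lc2 u v (- b) a /\ M u v v = lc2 u v (- c) b.

Lemma gram_lc2 u v a b c (x1 x2 y1 y2 z1 z2 : R) : gram u v a b c ->
  M (lc2 u v x1 x2) (lc2 u v y1 y2) (lc2 u v z1 z2) =
  (x1 * y2 - x2 * y1) *: lc2 u v (- (b * z1 + c * z2)) (a * z1 + b * z2).
Proof.
case=> Eu Ev; rewrite lts_lc2 {1}/lc2 !ltsD !ltsZ Eu Ev !lc2E.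
by congr lc2; ring.
Qed.

(** The law beta(x, z) y - beta(y, z) x does not depend on the basis, so the new entries are those
    of P G P^T, where P has rows (k, l) and (m, n). *)
Lemma gram_change u v a b c k l m n : gram u v a b c ->
  gram (lc2 u v k l) (lc2 u v m n)
    (k ^+ 2 * a + 2 * k * l * b + l ^+ 2 * c)
    (k * m * a + (k * n + l * m) * b + l * n * c)
    (m ^+ 2 * a + 2 * m * n * b + n ^+ 2 * c).
Proof.
move=> G; split; rewrite (gram_lc2 _ _ _ _ _ _ G) {2}/lc2 !lc2E.
  by congr lc2; ring.
by congr lc2; ring.
Qed.

Lemma subsystemP S :
  subsystem M S <-> forall x y z, x \in S -> y \in S -> z \in S -> M x y z \in S.
Proof. exact: triplevP. Qed.

Lemma idealP S D : ideal M S D <->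
  (D <= S)%VS /\ forall x y z, x \in D -> y \in S -> z \in S -> M x y z \in D.
Proof. by split=> -[? H]; split=> //; apply/triplevP. Qed.

Lemma subsystem_gram S u v : subsystem M S -> basis_of S [:: u; v] ->
  exists a b c, gram u v a b c.
Proof.
move=> /subsystemP SS B; have [uS vS] := basis2_mem B.
have [a [b Eu]] := mem_basis2 B (SS _ _ _ uS vS uS).
have [c [d Ev]] := mem_basis2 B (SS _ _ _ uS vS vS).
(* D = M u v is a derivation, so D (M u v w) = tr(D) M u v w + M u v (D w). *)
have tr w : (a + d) *: M u v w = 0.
  have E1 : M (M u v u) v w = a *: M u v w.
    by have := lts_lc2 M u v a b 0 1 w; rewrite lc2_01 Eu => ->; congr (_ *: _); ring.
  have E2 : M u (M u v v) w = d *: M u v w.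
    by have := lts_lc2 M u v 1 0 c d w; rewrite lc2_10 Ev => ->; congr (_ *: _); ring.
  have := lts_derivation M u v u v w.
  by rewrite E1 E2 -scalerDl -{1}[M u v _]add0r => /addIr.
(* Trace zero is exactly the symmetry of the Gram matrix; a nonzero trace forces [M u v] = 0, and
   then beta = 0 serves. *)
have [ad|ad] := eqVneq (a + d) 0.
  exists b, d, (- c); split; rewrite ?Eu ?Ev; congr lc2; lra.
have z w : M u v w = 0 by apply/eqP; have /eqP := tr w; rewrite scaler_eq0 (negPf ad).
by exists 0, 0, 0; split; rewrite z /lc2 oppr0 !scale0r addr0.
Qed.

(** Here [u] lies in the radical of beta, so (u, y, z) = - beta(y, z) u. *)
Lemma gram_line_ideal S u v c : basis_of S [:: u; v] -> gram u v 0 0 c ->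
  ideal M S <[u]>.
Proof.
move=> B G; have [uS vS] := basis2_mem B; apply/idealP; split.
  by rewrite -memvE.
move=> _ y z /vlineP[k ->] /(mem_basis2 B)[y1 [y2 ->]] /(mem_basis2 B)[z1 [z2 ->]].
rewrite -{1}(lc2_10 u v) lc2Z (gram_lc2 _ _ _ _ _ _ G) /lc2 !mul0r addr0.
by rewrite scale0r addr0 !memvZ ?memv_line.
Qed.

Lemma simple_gram_neq0 S u v c : basis_of S [:: u; v] -> simple M S ->
  ~ gram u v 0 0 c.
Proof.
move=> B [_ S_simple] /(gram_line_ideal B)/S_simple.
have nu : u != 0 by rewrite (basis_not0 B) ?inE ?eqxx.
have dS := @size_basis _ _ _ 2 [tuple u; v] B.
by case=> /(congr1 (fun W => \dim W)); rewrite dim_vline nu ?dimv0 ?dS.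
Qed.

Lemma gram_swap u v a b c : gram u v a b c -> gram v u c b a.
Proof.
move=> G; have := gram_change 0 1 1 0 G; rewrite lc2_10 lc2_01.
by congr gram; ring.
Qed.

Lemma basis_swap S u v : basis_of S [:: u; v] -> basis_of S [:: v; u].
Proof. by rewrite (@perm_basis _ _ _ [:: v; u]) // (perm_catC [:: u] [:: v]). Qed.

Lemma gram_diag_neq0 S u v a b c : basis_of S [:: u; v] -> gram u v a b c ->
  a != 0 -> exists w c', basis_of S [:: u; w] /\ gram u w a 0 c'.
Proof.
move=> B G a0; exists (lc2 u v (- b) a); eexists; split.
  by rewrite -{1}(lc2_10 u v); apply: basis2_change => //; rewrite mul1r mul0r subr0.
have := gram_change 1 0 (- b) a G; rewrite lc2_10.
have -> : 1 ^+ 2 * a + 2 * 1 * 0 * b + 0 ^+ 2 * c = a by ring.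
have -> : 1 * - b * a + (1 * a + 0 * - b) * b + 0 * a * c = 0 by ring.
exact.
Qed.

Lemma gram_diag S u v a b c : basis_of S [:: u; v] -> gram u v a b c ->
  exists u' v' a' c', basis_of S [:: u'; v'] /\ gram u' v' a' 0 c'.
Proof.
move=> B G; have [a0|/gram_diag_neq0] := eqVneq a 0; last first.
  by move=> /(_ _ _ _ _ _ B G)[w [c' H]]; exists u, w, a, c'.
have [c0|/gram_diag_neq0] := eqVneq c 0; last first.
  by move=> /(_ _ _ _ _ _ (basis_swap B) (gram_swap G))[w [c' H]]; exists v, w, c, c'.
have [b0|b0] := eqVneq b 0; first by exists u, v, a, c; rewrite -b0.
(* Both basis vectors are isotropic, but beta(u + v, u + v) = 2 b is nonzero, which reduces to the
   previous lemma. *)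
have B' : basis_of S [:: lc2 u v 1 1; v].
  rewrite -{2}(lc2_01 u v); apply: basis2_change => //.
  by rewrite mulr1 mulr0 subr0 oner_eq0.
have := gram_change 1 1 0 1 G; rewrite lc2_01 => G'.
have [|w [c' H]] := gram_diag_neq0 B' G'; last by do 4!eexists; exact: H.
by rewrite a0 c0 !mulr0 addr0 add0r !mulr1 mulf_neq0 // pnatr_eq0.
Qed.

Lemma sqr_scale_sg a : a != 0 -> exists2 k : R, k != 0 & k ^+ 2 * a = Num.sg a.
Proof.
move=> a0; have p : 0 < Num.sqrt `|a| by rewrite sqrtr_gt0 normr_gt0.
exists (Num.sqrt `|a|)^-1; first by rewrite invr_eq0 gt_eqF.
rewrite exprVn sqr_sqrtr // {2}[a]numEsg mulrC mulrK // unitfE normr_eq0 //.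
Qed.

(** Sylvester normal form: simplicity excludes a zero diagonal entry, rescaling turns the entries
    into their signs, and a swap puts 1 first when the signs differ. *)
Lemma gram_normalize S : \dim S = 2%N -> subsystem M S -> simple M S ->
  exists u v (p q : R), [/\ basis_of S [:: u; v], gram u v p 0 q &
    [\/ p = 1 /\ q = 1, p = -1 /\ q = -1 | p = 1 /\ q = -1]].
Proof.
move=> dS subS simS.
have [u0 [v0 B0]] : exists u v, basis_of S [:: u; v].
  move: (vbasis S) (vbasisP S); rewrite dS => -[[|u [|v []]] //= _] B.
  by exists u, v.
have [a0 [b0 [c0 /(gram_diag B0)]]] := subsystem_gram subS B0.
case=> [u [v [a [c [B G]]]]] {u0 v0 B0 a0 b0 c0}.
have a0 : a != 0.
  by apply/eqP => a0; rewrite a0 in G; exact: (simple_gram_neq0 B simS G).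
have c0 : c != 0.
  apply/eqP => c0; rewrite c0 in G.
  exact: (simple_gram_neq0 (basis_swap B) simS (gram_swap G)).
have [[k k0 Ek] [l l0 El]] := (sqr_scale_sg a0, sqr_scale_sg c0).
have B' : basis_of S [:: lc2 u v k 0; lc2 u v 0 l].
  by apply: basis2_change => //; rewrite mul0r subr0 mulf_neq0.
have := gram_change k 0 0 l G; move: (lc2 u v k 0) (lc2 u v 0 l) B' => u' v' B'.
rewrite !mulr0 !mul0r expr0n !mul0r !addr0 add0r Ek El => G'.
move: a0 c0 G'; case: (sgrP a) => [_|_|_]; rewrite ?eqxx // => _.
all: case: (sgrP c) => [_|_|_]; rewrite ?eqxx // => _ G'.
- by exists u', v', 1, 1; split=> //; constructor 1.
- by exists u', v', 1, (-1); split=> //; constructor 3.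
- exists v', u', 1, (-1); split; [exact: basis_swap|exact: gram_swap|].
  by constructor 3.
- by exists u', v', (-1), (-1); split=> //; constructor 2.
Qed.

End Gram.

(** * Adapted bases of a splitting system and the parameters s, t *)

Section Table.
Variables (R : realType) (V : vectType R) (M : lts V).
Implicit Types (u v x y z e : V) (p q s t : R).

(* M2 carries beta = diag(p, q), and (e1, x, y) = sigma(x, y) e1 on M2 with
   sigma = s beta + t omega, omega(e2, e3) = 1. *)
Record std_table e1 e2 e3 p q s t : Prop := StdTable {
  std121 : M e1 e2 e1 = 0;
  std122 : M e1 e2 e2 = (s * p) *: e1;
  std123 : M e1 e2 e3 = t *: e1;
  std131 : M e1 e3 e1 = 0;
  std132 : M e1 e3 e2 = (- t) *: e1;
  std133 : M e1 e3 e3 = (s * q) *: e1;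
  std231 : M e2 e3 e1 = (- (2 * t)) *: e1;
  std23 : gram M e2 e3 p 0 q
}.

Definition adapted (M1 M2 : {vspace V}) e1 e2 e3 p q s t : Prop :=
  [/\ basis_of fullv [:: e1; e2; e3], M1 = <[e1]>%VS, M2 = <<[:: e2; e3]>>%VS
    & std_table e1 e2 e3 p q s t].

Lemma std_opE e1 e2 e3 p q s t : std_table e1 e2 e3 p q s t ->
  forall x1 x2 x3 y1 y2 y3 z1 z2 z3 : R,
  let m12 := x1 * y2 - x2 * y1 in
  let m13 := x1 * y3 - x3 * y1 in
  let m23 := x2 * y3 - x3 * y2 in
  M (lc3 e1 e2 e3 x1 x2 x3) (lc3 e1 e2 e3 y1 y2 y3) (lc3 e1 e2 e3 z1 z2 z3) =
  lc3 e1 e2 e3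
    (m12 * (s * p * z2 + t * z3) + m13 * (s * q * z3 - t * z2) - 2 * t * m23 * z1)
    (- q * m23 * z3) (p * m23 * z2).
Proof.
case=> E1 E2 E3 E4 E5 E6 E7 [E8 E9] x1 x2 x3 y1 y2 y3 z1 z2 z3 m12 m13 m23.
rewrite lts_lc3 -/m12 -/m13 -/m23.
set Rhs := RHS; rewrite /lc3 !(ltsD, ltsZ) E1 E2 E3 E4 E5 E6 E7 E8 E9 /lc2 {}/Rhs.
move: (lc3D e1 e2 e3) (lc3Z e1 e2 e3) (lc3N e1 e2 e3) (lc3_000 e1 e2 e3)
  (lc3_100 e1 e2 e3) (lc3_010 e1 e2 e3) (lc3_001 e1 e2 e3).
move: (lc3 e1 e2 e3) => L LD LZ LN <- <- <- <-.
rewrite !(LD, LZ, LN).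
by congr L; ring.
Qed.

Lemma std_constraints e1 e2 e3 p q s t : basis_of fullv [:: e1; e2; e3] ->
  std_table e1 e2 e3 p q s t -> p != 0 ->
  t * (1 + 4 * s) = 0 /\ s * (1 + s) * (p * q) = 3 * t ^+ 2.
Proof.
move=> B T p0; have F := basis_free B; pose L := lc3 e1 e2 e3.
(* The derivations (e1, e2, -) and (e1, e3, -) are applied to (e2, e3, e2). Comparing
   e1-coordinates, the first gives p t (1 + 4 s) = 0 and the second s (1 + s) p q = 3 t^2. *)
have := lts_derivation M (L 1 0 0) (L 0 1 0) (L 0 1 0) (L 0 0 1) (L 0 1 0).
have := lts_derivation M (L 1 0 0) (L 0 0 1) (L 0 1 0) (L 0 0 1) (L 0 1 0).
rewrite /L !(std_opE T) !lc3E.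
move=> /(lc3_inj F)[H1 _ _] /(lc3_inj F)[H2 _ _].
by split; [apply: (mulfI p0); lra | lra].
Qed.

Lemma memv_triplev (A B C : {vspace V}) x y z :
  x \in A -> y \in B -> z \in C -> M x y z \in triplev M A B C.
Proof. by move: x y z; apply/triplevP. Qed.

(** If (e, x, e) = a e with a nonzero, then (x, e, e) = - a e keeps [e] in every derived term,
    against solvability. *)
Lemma solvable_line e x : e != 0 -> ideal M fullv <[e]> -> solvable M <[e]> ->
  M e x e = 0.
Proof.
move=> e0 /idealP[_ I] [k dk].
have [a Ea] : exists a, M e x e = a *: e by apply/vlineP/I; rewrite ?memvf ?memv_line.
have [a0|a0] := eqVneq a 0; first by rewrite Ea a0 scale0r.
have /(_ k.+1) : forall n, e \in derived M <[e]> n.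
  elim=> [|n IH]; first exact: memv_line.
  have /(memvZ (- a)^-1) := memv_triplev (memvf x) IH IH.
  by rewrite lts_antisym Ea -scaleNr scalerA mulVf ?oppr_eq0 // scale1r.
by rewrite dk memv0 (negPf e0).
Qed.

Lemma splitting_adapted (M1 M2 : {vspace V}) : splitting M M1 M2 ->
  exists e1 e2 e3 p q s t, adapted M1 M2 e1 e2 e3 p q s t /\
    [\/ p = 1 /\ q = 1, p = -1 /\ q = -1 | p = 1 /\ q = -1].
Proof.
case=> -[d3 S12 D12] [d1 I1 S1] [d2 sub2 sim2].
have [e2 [e3 [p [q [B2 G pq]]]]] := gram_normalize d2 sub2 sim2.
have [e1 B1] : exists e, basis_of M1 [:: e].
  by move: (vbasis M1) (vbasisP M1); rewrite d1 => -[[|e []] //= _] B; exists e.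
have M1E : M1 = <[e1]>%VS by rewrite -span_seq1 (span_basis B1).
have e10 : e1 != 0 by rewrite (basis_not0 B1) ?inE.
rewrite M1E in I1 S1; have nil1 x : M e1 x e1 = 0 := solvable_line x e10 I1 S1.
have B : basis_of fullv [:: e1; e2; e3] by rewrite -S12 (cat_basis D12 B1 B2).
have /idealP[_ I] := I1; have F := basis_free B.
have line x y : exists a, M e1 x y = a *: e1.
  by apply/vlineP/I; rewrite ?memvf ?memv_line.
have [a22 E22] := line e2 e2; have [a23 E23] := line e2 e3.
have [a32 E32] := line e3 e2; have [a33 E33] := line e3 e3.
have E : M e2 e3 e1 = (a32 - a23) *: e1.
  have := lts_cyclic M e1 e2 e3; rewrite (lts_antisym M e1 e3) E23 E32.
  by move/eqP; rewrite subr_eq0 addrC eq_sym -subr_eq -scalerBl => /eqP <-.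
have [Eu Ev] := G.
have p1 : p * p = 1 by case: pq => -[-> _]; ring.
(* M e2 e3 acts on e1 by a scalar, so the derivation identity makes it skew
   for sigma. *)
have inv x y : M e1 (M e2 e3 x) y + M e1 x (M e2 e3 y) = 0.
  have [a Ea] := line x y; have := lts_derivation M e2 e3 e1 x y.
  by rewrite E Ea !ltsZ E Ea !scalerA (mulrC a) -addrA -[LHS]addr0 => /addrI <-.
(* The pair (e2, e2) gives p (a32 + a23) = 0 and the pair (e2, e3) gives p a33 = q a22. *)
have := inv e2 e2; have := inv e2 e3.
rewrite Eu Ev /lc2 !(ltsD, ltsZ) E22 E23 E32 E33 !scalerA -!scalerDl.
have sc0 a : a *: e1 = 0 -> a = 0.
  by move/eqP; rewrite scaler_eq0 (negPf e10) orbF => /eqP.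
move=> /sc0 H1 /sc0 H2.
(* Since p^2 = 1, the equation s p = a22 is solved by s = p a22. *)
exists e1, e2, e3, p, q, (p * a22), a23; split=> //; split=> //.
  by rewrite (span_basis B2).
have H : a32 = - a23 by case: pq => -[Ep _]; rewrite Ep in H2; lra.
split=> //.
- by rewrite E22; congr (_ *: _); ring: p1.
- by rewrite E32 H.
- by rewrite E33; congr (_ *: _); case: pq => -[Ep Eq]; rewrite Ep Eq in H1 *; lra.
- by rewrite E H; congr (_ *: _); ring.
Qed.

End Table.

(** * The solutions (s, t) of the two equations and their types *)

Section Form.
Variable R : realType.

Definition diag1 (f : form2) : R := if f is SL2_SO2 then -1 else 1.

Definition diag2 (f : form2) : R := if f is SO3_SO2 then 1 else -1.

Lemma diag1_neq0 f : diag1 f != 0.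
Proof. by case: f; rewrite /= ?oppr_eq0 oner_eq0. Qed.

Lemma diag2_neq0 f : diag2 f != 0.
Proof. by case: f; rewrite /= ?oppr_eq0 oner_eq0. Qed.

Lemma form2_mxE f i j : form2_mx R f i j =
  if i == j then (if i == 0 then diag1 f else diag2 f) else 0.
Proof.
by case: f; rewrite /= mxE; case: i j => [[|[|//]] ?] [[|[|//]] ?].
Qed.

Definition type_params (k : splitType) (f : form2) (s t : R) : Prop :=
  match k with
  | Ty1 => s = 0 /\ t = 0
  | Ty2 => [/\ f = SO3_SO2, s = -1 & t = 0]
  | Ty3 => [/\ f = SL2_SO2, s = -1 & t = 0]
  | Ty4 => [/\ f = SL2_R, s = -1 & t = 0]
  | Ty5 => [/\ f = SL2_R, s = - 4^-1 & t = 4^-1]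
  | Ty6 => [/\ f = SL2_R, s = - 4^-1 & t = - 4^-1]
  end.

(** If t = 0, then s (1 + s) = 0. Otherwise s = -1/4 and 16 t^2 = - p q with p q = 1 or -1, so p q =
    -1 and t = 1/4 or -1/4. *)
Lemma type_params_exhaust f s t :
  t * (1 + 4 * s) = 0 -> s * (1 + s) * (diag1 f * diag2 f) = 3 * t ^+ 2 ->
  exists k, type_params k f s t.
Proof.
move=> /eqP; rewrite mulf_eq0 => /orP[/eqP-> | s4] H.
  move: H; rewrite expr0n mulr0 => /eqP.
  rewrite !mulf_eq0 (negPf (diag1_neq0 f)) (negPf (diag2_neq0 f)) !orbF.
  case/orP=> [/eqP->|s1]; first by exists Ty1.
  have -> : s = -1 by lra.
  by case: f; [exists Ty2|exists Ty3|exists Ty4].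
have Es : s = - 4^-1 by lra.
have t2 : 16 * t ^+ 2 = - (diag1 f * diag2 f) by rewrite Es in H; lra.
have fE : f = SL2_R by have := sqr_ge0 t; case: f t2 {H} => //= t2 t0; exfalso; lra.
have : (4 * t - 1) * (4 * t + 1) = 0 by rewrite fE /= in t2; lra.
move/eqP; rewrite mulf_eq0 => /orP[t4|t4].
  by exists Ty5; split=> //; lra.
by exists Ty6; split=> //; lra.
Qed.

Lemma type_params_constraints k f s t : type_params k f s t ->
  t * (1 + 4 * s) = 0 /\ s * (1 + s) * (diag1 f * diag2 f) = 3 * t ^+ 2.
Proof. by case: k => /= -[]; do ?[move=> ->]; split=> /=; field. Qed.

End Form.

(** * Form and simplicity read off from a diagonal Gram matrix *)

Section Adapted.
Variables (R : realType) (V : vectType R) (M : lts V).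
Implicit Types (u v x y z e : V) (p q s t : R) (f : form2) (S : {vspace V}).

Lemma gram_of_form2 f S u v : basis_of S [:: u; v] ->
  gram M u v (diag1 R f) 0 (diag2 R f) -> of_form2 M f S.
Proof.
move=> B G; exists [tuple u; v]; split=> // beta x y z xS yS zS.
pose c0 w := coord [tuple u; v] ord0 w.
pose c1 w := coord [tuple u; v] (lift ord0 ord0) w.
have E w : w \in S -> w = lc2 u v (c0 w) (c1 w).
  move=> wS; have := @coord_basis _ _ _ 2 [tuple u; v] w B wS.
  by rewrite !big_ord_recl big_ord0 addr0.
have betaE x' y' : beta x' y' = c0 x' * diag1 R f * c0 y' + c1 x' * diag2 R f * c1 y'.
  rewrite /beta /gram_form !big_ord_recl !big_ord0 !form2_mxE /=.
  by rewrite !(mulr0, mul0r, addr0, add0r).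
rewrite !betaE; move: (E x xS) (E y yS) (E z zS).
move: (c0 x) (c1 x) (c0 y) (c1 y) (c0 z) (c1 z) => x1 x2 y1 y2 z1 z2 -> -> ->.
rewrite (gram_lc2 _ _ _ _ _ _ G) !lc2E.
by congr lc2; ring.
Qed.

(** An ideal containing one of [u], [v] contains the other, as (u, v, u) = p v and (u, v, v) = - q
    u. A nonzero w = a u + b v in it produces one of them, as (w, v, u) = a p v and (w, u, v) = b q
    u. *)
Lemma simple_of_gram S u v p q : basis_of S [:: u; v] -> gram M u v p 0 q ->
  p != 0 -> q != 0 -> simple M S.
Proof.
move=> B G p0 q0; have [uS vS] := basis2_mem B; have [Eu Ev] := G.
have nu : u != 0 by rewrite (basis_not0 B) ?inE ?eqxx.
have nv : v != 0 by rewrite (basis_not0 B) ?inE ?eqxx ?orbT.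
split=> [/(_ _ _ _ uS vS uS)|D /idealP[DS DI]].
  by rewrite Eu /lc2 oppr0 scale0r add0r => /eqP; rewrite scaler_eq0 (negPf p0) (negPf nv).
have [D0|Dn0] := eqVneq D 0%VS; [by left | right].
have both : u \in D -> v \in D -> D = S.
  move=> uD vD; apply/eqP; rewrite eqEsubv DS -(span_basis B).
  by apply/span_subvP=> w; rewrite !inE => /orP[] /eqP ->.
have uv : (u \in D) = (v \in D).
  apply/idP/idP=> H.
    have := DI _ _ _ H vS uS.
    by rewrite Eu /lc2 oppr0 scale0r add0r rpredZeq (negPf p0).
  have := DI _ _ _ H uS vS.
  rewrite lts_antisym Ev /lc2 scale0r addr0 rpredN rpredZeq oppr_eq0.
  by rewrite (negPf q0).
suff : u \in D by move=> uD; apply: both; rewrite -?uv.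
have [a [b E]] := mem_basis2 B (subvP DS _ (memv_pick D)).
have := memv_pick D; move: Dn0; rewrite -vpick0 E {E} => w0 wD.
have [a0|a0] := eqVneq a 0; last first.
  have := DI _ _ _ wD vS uS; rewrite -{2}(lc2_01 u v) lts_lc2 uv Eu /lc2.
  by rewrite oppr0 scale0r add0r mulr1 mulr0 subr0 !rpredZeq (negPf a0) (negPf p0).
have := DI _ _ _ wD uS vS; rewrite -{2}(lc2_10 u v) lts_lc2 Ev /lc2.
rewrite scale0r addr0 mulr0 mulr1 sub0r !rpredZeq !oppr_eq0 (negPf q0) /= => /orP[/eqP b0|//].
by rewrite a0 b0 /lc2 !scale0r addr0 eqxx in w0.
Qed.

End Adapted.

(** * Translation between the listed types and the parameters *)

Section Types.
Variables (R : realType) (V : vectType R) (M : lts V).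
Implicit Types (u v x y z e : V) (p q s t : R) (f : form2).

Lemma adapted_splitting (M1 M2 : {vspace V}) e1 e2 e3 p q s t :
  adapted M M1 M2 e1 e2 e3 p q s t -> p != 0 -> q != 0 -> splitting M M1 M2.
Proof.
case=> B -> -> T p0 q0.
have /and3P[] : [&& free [:: e1], free [:: e2; e3]
    & directv (<<[:: e1]>> + <<[:: e2; e3]>>)].
  by rewrite -cat_free (basis_free B).
rewrite seq1_free span_seq1 => e10 F2 D.
have B2 : basis_of <<[:: e2; e3]>> [:: e2; e3] by rewrite /basis_of eqxx.
have I1 : forall y z, M e1 y z \in <[e1]>%VS.
  move=> y z; have [y1 [y2 [y3 ->]]] := basis3P y B.
  have [z1 [z2 [z3 ->]]] := basis3P z B.
  rewrite -{1}(lc3_100 e1 e2 e3) (std_opE T) /lc3.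
  by rewrite mul0r !(mulr0, mul0r, subr0, scale0r, addr0) memvZ ?memv_line.
have I : ideal M fullv <[e1]>.
  apply/idealP; split=> [|_ y z /vlineP[k ->] _ _]; first exact: subvf.
  by rewrite ltsZ memvZ.
have G := std23 T.
split; split=> //.
- exact: (@size_basis _ _ _ 3 [tuple e1; e2; e3] B).
- by rewrite -span_cons (span_basis B).
- by rewrite dim_vline e10.
(* Already the first derived term vanishes, because (x, e1, e1) = 0. *)
- exists 0%N; apply/eqP; rewrite -subv0 /=; apply/triplevP => x y z _.
  move=> /vlineP[k ->] /vlineP[l ->]; rewrite !ltsZ.
  suff -> : M x e1 e1 = 0 by rewrite !scaler0 mem0v.
  have [x1 [x2 [x3 ->]]] := basis3P x B.
  rewrite -{2 3}(lc3_100 e1 e2 e3) (std_opE T).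
  by rewrite -(lc3_000 e1 e2 e3); congr lc3; ring.
- exact: (@size_basis _ _ _ 2 [tuple e2; e3] B2).
- apply/subsystemP=> x y z /mem_span2P[x1 [x2 ->]] /mem_span2P[y1 [y2 ->]].
  move=> /mem_span2P[z1 [z2 ->]]; rewrite (gram_lc2 _ _ _ _ _ _ G) lc2Z.
  by apply/mem_span2P; do 2!eexists.
- exact: simple_of_gram B2 G p0 q0.
Qed.

Lemma has_matrixP e1 e2 e3 (h : V -> V) rows :
  let c j := lc3 e1 e2 e3 (nth [::] rows 0)`_j (nth [::] rows 1)`_j
               (nth [::] rows 2)`_j in
  has_matrix [tuple e1; e2; e3] h (mx_of_rows 3 rows) <->
  [/\ h e1 = c 0%N, h e2 = c 1%N & h e3 = c 2%N].
Proof.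
have E j : \sum_i mx_of_rows 3 rows i j *: tnth [tuple e1; e2; e3] i =
    lc3 e1 e2 e3 (nth [::] rows 0)`_j (nth [::] rows 1)`_j (nth [::] rows 2)`_j.
  by rewrite !big_ord_recl big_ord0 !mxE !(tnth_nth 0) addr0 addrA.
split=> [H|[h0 h1 h2] j]; last by rewrite E (tnth_nth 0); case: j => [[|[|[|]]]].
by split; [have := H (inord 0)|have := H (inord 1)|have := H (inord 2)];
   rewrite E (tnth_nth 0) !inordK.
Qed.

(** The columns of A, B, C are the entries of [std_table]; the signs in the last matrix come from
    (e3, e1, -) = - (e1, e3, -). *)
Lemma has_matrices_adapted (M1 M2 : {vspace V}) p q s t (a2 a3 b1 b2 b3 c2 c3 : R) :
  [/\ a2 = s * p, a3 = t, c2 = t & c3 = - (s * q)] ->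
  [/\ b1 = - (2 * t), b2 = p & b3 = - q] ->
  has_matrices M M1 M2
    (mx_of_rows 3 [:: [:: 0; a2; a3]; [:: 0; 0; 0]; [:: 0; 0; 0]])
    (mx_of_rows 3 [:: [:: b1; 0; 0]; [:: 0; 0; b3]; [:: 0; b2; 0]])
    (mx_of_rows 3 [:: [:: 0; c2; c3]; [:: 0; 0; 0]; [:: 0; 0; 0]]) <->
  exists e1 e2 e3, adapted M M1 M2 e1 e2 e3 p q s t.
Proof.
case=> -> -> -> -> [-> -> ->].
split=> -[e1 [e2 [e3]]].
  case=> -[B E1 E2] [] /has_matrixP/= [A1 A2 A3] /has_matrixP/= [B1 B2 B3].
  move=> /has_matrixP/= [C1 C2 C3]; exists e1, e2, e3; split=> //.
  rewrite /lc3 !scale0r !(addr0, add0r) in A1 A2 A3 B1 B2 B3 C1 C2 C3.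
  split=> //; first 1 last.
  - by rewrite lts_antisym C2 scaleNr.
  - by rewrite lts_antisym C3 scaleNr opprK.
  - by split; rewrite /lc2 ?oppr0 ?B2 ?B3 !scale0r ?(add0r, addr0).
  by rewrite lts_antisym C1 oppr0.
case=> B E1 E2 [T1 T2 T3 T4 T5 T6 T7 [T8 T9]]; exists e1, e2, e3; split=> //.
by split; apply/has_matrixP; split=> /=;
  rewrite ?(lts_antisym M e1 e3) /lc3 ?(T1, T2, T3, T4, T5, T6, T7, T8, T9) /lc2
    ?oppr0 ?scale0r ?(addr0, add0r, oppr0) ?scaleNr ?opprK.
Qed.

Lemma splitting_adapted_form (M1 M2 : {vspace V}) : splitting M M1 M2 ->
  exists f s t e1 e2 e3, adapted M M1 M2 e1 e2 e3 (diag1 R f) (diag2 R f) s t.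
Proof.
move=> /splitting_adapted[e1 [e2 [e3 [p [q [s [t [A pq]]]]]]]].
have [f [Ep Eq]] : exists f, p = diag1 R f /\ q = diag2 R f.
  by case: pq; [exists SO3_SO2|exists SL2_SO2|exists SL2_R].
by exists f, s, t, e1, e2, e3; rewrite -Ep -Eq.
Qed.

Lemma adapted_basis2 (M1 M2 : {vspace V}) e1 e2 e3 p q s t :
  adapted M M1 M2 e1 e2 e3 p q s t -> basis_of M2 [:: e2; e3].
Proof.
case=> /basis_free; rewrite (cat_free [:: e1]) => /and3P[_ F _] _ -> _.
by rewrite /basis_of eqxx.
Qed.

Lemma adapted_of_form2 (M1 M2 : {vspace V}) e1 e2 e3 f s t :
  adapted M M1 M2 e1 e2 e3 (diag1 R f) (diag2 R f) s t -> of_form2 M f M2.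
Proof.
move=> A; have B2 := adapted_basis2 A; case: A => _ _ _ T.
exact: gram_of_form2 B2 (std23 T).
Qed.

Lemma adapted_Ty1 (M1 M2 : {vspace V}) e1 e2 e3 f :
  adapted M M1 M2 e1 e2 e3 (diag1 R f) (diag2 R f) 0 0 -> has_type M Ty1 M1 M2.
Proof.
move=> A; have form := adapted_of_form2 A.
have [[d S D] [d1 I1 _] [_ _ sim]] :=
  adapted_splitting A (diag1_neq0 R f) (diag2_neq0 R f).
case: A form d1 I1 sim D S => B -> -> T form d1 I1 sim D S; split=> //; last by exists f.
  by move=> _ _ z /vlineP[k ->] /vlineP[l ->] _; rewrite !ltsZ lts_alt !scaler0.
apply/idealP; split=> [|_ y z /mem_span2P[x2 [x3 ->]] _ _]; first exact: subvf.
have [y1 [y2 [y3 ->]]] := basis3P y B; have [z1 [z2 [z3 ->]]] := basis3P z B.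
have -> : lc2 e2 e3 x2 x3 = lc3 e1 e2 e3 0 x2 x3 by rewrite /lc3 scale0r add0r.
rewrite (std_opE T) /lc3 !(mul0r, mulr0, addr0, subr0, oppr0).
by rewrite scale0r add0r; apply/mem_span2P; do 2!eexists.
Qed.

(** Each (e2, e1, x) lies in the ideal M2; for x = e2, e3 it is - s p e1 and - t e1, while e1 is not
    in M2. *)
Lemma ideal_adapted (M1 M2 : {vspace V}) e1 e2 e3 p q s t :
  adapted M M1 M2 e1 e2 e3 p q s t -> p != 0 -> ideal M fullv M2 ->
  s = 0 /\ t = 0.
Proof.
case=> /basis_free; rewrite free_cons => /andP[e1n _] _ -> T p0 /idealP[_ I].
have H x : M e2 e1 x \in <<[:: e2; e3]>>%VS.
  by apply: I; rewrite ?memvf // memv_span // !inE eqxx.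
have := H e2; have := H e3; rewrite !(lts_antisym M e1 e2) (std122 T) (std123 T) !rpredN.
rewrite !rpredZeq (negPf e1n) !orbF mulf_eq0 (negPf p0) orbF.
by move=> /eqP-> /eqP->.
Qed.

(** Reduces classification, existence and non-isomorphism to statements about the form and the
    parameters s, t. *)
Lemma has_typeP k (M1 M2 : {vspace V}) : splitting M M1 M2 -> has_type M k M1 M2 <->
  exists f s t e1 e2 e3, type_params k f s t /\
    adapted M M1 M2 e1 e2 e3 (diag1 R f) (diag2 R f) s t.
Proof.
move=> Spl; split=> [|[f [s [t [e1 [e2 [e3 [K A]]]]]]]]; last first.
  have form := adapted_of_form2 A.
  case: k K => /= [[s0 t0]|||||]; first by rewrite s0 t0 in A; exact: adapted_Ty1 A.
  1-5: case=> Ef Es Et; rewrite Ef in form; split=> //.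
  1-5: apply/(has_matrices_adapted M1 M2); last (by exists e1, e2, e3; exact: A).
  1-10: by rewrite Ef ?Es ?Et; split=> /=; field.
have E := has_matrices_adapted M1 M2.
case: k => /= [|[H _]|[H _]|[H _]|[H _]|[H _]].
- case=> _ _ I _ _; have [f [s [t [e1 [e2 [e3 A]]]]]] := splitting_adapted_form Spl.
  by exists f, s, t, e1, e2, e3; split=> //; exact: ideal_adapted A (diag1_neq0 R f) I.
- exists SO3_SO2, (-1), 0.
  have [||e1 [e2 [e3 A]]] := proj1 (E 1 1 (-1) 0 _ _ _ _ _ _ _ _ _) H.
  1-2: by split; field.
  by exists e1, e2, e3.
- exists SL2_SO2, (-1), 0.
  have [||e1 [e2 [e3 A]]] := proj1 (E (-1) (-1) (-1) 0 _ _ _ _ _ _ _ _ _) H.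
  1-2: by split; field.
  by exists e1, e2, e3.
- exists SL2_R, (-1), 0.
  have [||e1 [e2 [e3 A]]] := proj1 (E 1 (-1) (-1) 0 _ _ _ _ _ _ _ _ _) H.
  1-2: by split; field.
  by exists e1, e2, e3.
- exists SL2_R, (- 4^-1), 4^-1.
  have [||e1 [e2 [e3 A]]] := proj1 (E 1 (-1) (- 4^-1) 4^-1 _ _ _ _ _ _ _ _ _) H.
  1-2: by split; field.
  by exists e1, e2, e3.
- exists SL2_R, (- 4^-1), (- 4^-1).
  have [||e1 [e2 [e3 A]]] := proj1 (E 1 (-1) (- 4^-1) (- 4^-1) _ _ _ _ _ _ _ _ _) H.
  1-2: by split; field.
  by exists e1, e2, e3.
Qed.

End Types.

(** * Realization on R^3 of every solution of the two equations *)

Section Model.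
Variables (R : realType) (p q s t : R).
Local Notation R3 := (R^o * R^o * R^o)%type.

(** The coordinate formula of [std_opE], read in the standard basis. *)
Definition std_op (x y z : R3) : R3 :=
  let m12 := x.1.1 * y.1.2 - x.1.2 * y.1.1 : R in
  let m13 := x.1.1 * y.2 - x.2 * y.1.1 : R in
  let m23 := x.1.2 * y.2 - x.2 * y.1.2 : R in
  (m12 * (s * p * z.1.2 + t * z.2) + m13 * (s * q * z.2 - t * z.1.2)
     - 2 * t * m23 * z.1.1,
   - q * m23 * z.2, p * m23 * z.1.2).

Lemma std_trilinear : trilinear std_op.
Proof.
by split=> [y z|x z|x y] k u v; congr (_, _, _);
   rewrite /= /GRing.scale /=; ring.
Qed.

Lemma std_alt x y : std_op x x y = 0.
Proof. by congr (_, _, _) => /=; ring. Qed.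

Lemma std_cyclic x y z : std_op x y z + std_op y z x + std_op z x y = 0.
Proof. by congr (_, _, _) => /=; ring. Qed.

Hypothesis ht : t * (1 + 4 * s) = 0.
Hypothesis hs : s * (1 + s) * (p * q) = 3 * t ^+ 2.

Lemma std_derivation x y u v w :
  std_op x y (std_op u v w) =
  std_op (std_op x y u) v w + std_op u (std_op x y v) w + std_op u v (std_op x y w).
Proof.
case: x y u v w => [[x1 x2] x3] [[y1 y2] y3] [[u1 u2] u3] [[v1 v2] v3] [[w1 w2] w3].
rewrite /std_op; congr (_, _, _) => /=; [|ring|ring].
(* Only the e1-coordinate involves s and t. The constraints become rewriting rules for [ring] and
   [field]: s^2 p q = - s p q if t = 0, and s = -1/4, p q = - 16 t^2 otherwise. *)
have [t0|] := eqVneq t 0.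
  have hs' : s ^+ 2 * p * q = - (s * p * q) by have := hs; rewrite t0; lra.
  by rewrite t0; ring: hs'.
move=> /mulfI tI; have s4 : s = - 4^-1.
  have : 1 + 4 * s = 0 by apply: tI; rewrite ht mulr0.
  by lra.
have pq : p * q = - 16 * t ^+ 2 by have := hs; rewrite s4; lra.
by rewrite s4; field: pq.
Qed.

Definition std_lts : lts R3 := Lts std_trilinear std_alt std_cyclic std_derivation.

Lemma std_lts_adapted : exists M1 M2 e1 e2 e3,
  adapted std_lts M1 M2 e1 e2 e3 p q s t.
Proof.
pose e1 : R3 := (1, 0, 0); pose e2 : R3 := (0, 1, 0); pose e3 : R3 := (0, 0, 1).
exists <[e1]>%VS, <<[:: e2; e3]>>%VS, e1, e2, e3; split=> //.
  rewrite basisEdim dimvf andbT; apply/subvP=> -[[a b] c] _.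
  rewrite span_cons; apply/memv_addP; exists (a *: e1); first by rewrite memvZ ?memv_line.
  exists (lc2 e2 e3 b c); first by apply/mem_span2P; exists b, c.
  by congr (_, _, _); rewrite /= /GRing.scale /=; ring.
by split; do ?split; congr (_, _, _); rewrite /= /GRing.scale /=; ring.
Qed.

End Model.

(** * Isomorphisms between systems with equal parameters *)

Section Isomorphism.
Variables (R : realType) (V W : vectType R) (M : lts V) (N : lts W).

Lemma lts_iso_sym : lts_iso M N -> lts_iso N M.
Proof.
case=> f [[g fK gK] fM].
have g_lin : linear g by apply: can2_linear fK gK.
pose g' : {linear W -> V} := HB.pack g (GRing.isLinear.Build _ _ _ _ g g_lin).
exists (linfun g'); split.
  by exists f => x; rewrite lfunE /= ?fK ?gK.
by move=> x y z; rewrite !lfunE /= -{1}(gK x) -{1}(gK y) -{1}(gK z) -fM fK.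
Qed.

(** By [std_opE] the parameters determine the operation in coordinates, so matching the adapted
    bases is an isomorphism. *)
Lemma adapted_iso (M1 M2 : {vspace V}) (N1 N2 : {vspace W}) e1 e2 e3 e1' e2' e3' p q s t :
  adapted M M1 M2 e1 e2 e3 p q s t -> adapted N N1 N2 e1' e2' e3' p q s t ->
  lts_iso M N.
Proof.
case=> B _ _ T [B' _ _ T'].
have [f /(_ (basis_free B) erefl)[f1 f2 f3]] :=
  linear_of_free [:: e1; e2; e3] [:: e1'; e2'; e3'].
have [g /(_ (basis_free B') erefl)[g1 g2 g3]] :=
  linear_of_free [:: e1'; e2'; e3'] [:: e1; e2; e3].
have fE a b c : f (lc3 e1 e2 e3 a b c) = lc3 e1' e2' e3' a b c.
  by rewrite /lc3 !linearD !linearZ /= f1 f2 f3.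
have gE a b c : g (lc3 e1' e2' e3' a b c) = lc3 e1 e2 e3 a b c.
  by rewrite /lc3 !linearD !linearZ /= g1 g2 g3.
exists (linfun f); split.
  exists g => x; rewrite lfunE /=.
    by have [a [b [c ->]]] := basis3P x B; rewrite fE gE.
  by have [a [b [c ->]]] := basis3P x B'; rewrite gE fE.
move=> x y z; rewrite !lfunE /=.
have [x1 [x2 [x3 ->]]] := basis3P x B; have [y1 [y2 [y3 ->]]] := basis3P y B.
have [z1 [z2 [z3 ->]]] := basis3P z B.
by rewrite !fE (std_opE T) (std_opE T') fE.
Qed.

End Isomorphism.

(** * Values of the separating invariants in terms of the parameters *)

Section Invariants.
Variables (R : realType) (V : vectType R) (M : lts V).

Definition left_null : Prop := exists2 v, v != 0 & forall x y, M v x y = 0.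

Definition right_null : Prop := exists2 v, v != 0 & forall x y, M x y v = 0.

(* Independent x, y in M2 with M x y x = eps y are beta-orthogonal, with
   beta(x, x) = eps: this detects the signs of the values of beta. *)
Definition self_eigen (eps : R) : Prop :=
  exists x, exists2 y, y != 0 & M x y x = eps *: y.

Variables (e1 e2 e3 : V) (p q s t : R).
Hypotheses (B : basis_of fullv [:: e1; e2; e3]) (T : std_table M e1 e2 e3 p q s t).

Let F := basis_free B.

Let op := std_opE T.

Let e1_neq0 : e1 != 0. Proof. by rewrite (free_not0 F) ?inE ?eqxx. Qed.

Let e2_neq0 : e2 != 0. Proof. by rewrite (free_not0 F) ?inE ?eqxx ?orbT. Qed.

Let e3_neq0 : e3 != 0. Proof. by rewrite (free_not0 F) ?inE ?eqxx ?orbT. Qed.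

Lemma left_null_std : s = 0 -> t = 0 -> left_null.
Proof.
move=> s0 t0; exists e1 => // x y.
have [x1 [x2 [x3 ->]]] := basis3P x B; have [y1 [y2 [y3 ->]]] := basis3P y B.
rewrite -{1}(lc3_100 e1 e2 e3) op s0 t0 -(lc3_000 e1 e2 e3).
by congr lc3; ring.
Qed.

Lemma not_left_null_std : p != 0 -> q != 0 -> s != 0 -> ~ left_null.
Proof.
move=> p0 q0 s0 [v v0 vn]; have [v1 [v2 [v3 Ev]]] := basis3P v B.
(* (v, e2, e2) = s p v1 e1 - p v3 e3, and (v, e3, e3) has e2-coordinate - q v2. *)
have := vn (lc3 e1 e2 e3 0 1 0) (lc3 e1 e2 e3 0 1 0).
have := vn (lc3 e1 e2 e3 0 0 1) (lc3 e1 e2 e3 0 0 1).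
rewrite Ev !op -(lc3_000 e1 e2 e3) => /(lc3_inj F)[_ H2 _] /(lc3_inj F)[H1 _ H3].
have Ev1 : v1 = 0 by apply: (mulfI s0); apply: (mulfI p0); lra.
have Ev2 : v2 = 0 by apply: (mulfI q0); lra.
have Ev3 : v3 = 0 by apply: (mulfI p0); lra.
by move: v0; rewrite Ev Ev1 Ev2 Ev3 lc3_000 eqxx.
Qed.

Lemma right_null_std : t = 0 -> right_null.
Proof.
move=> t0; exists e1 => // x y.
have [x1 [x2 [x3 ->]]] := basis3P x B; have [y1 [y2 [y3 ->]]] := basis3P y B.
rewrite -{3}(lc3_100 e1 e2 e3) op t0 -(lc3_000 e1 e2 e3).
by congr lc3; ring.
Qed.

Lemma not_right_null_std : p != 0 -> q != 0 -> t != 0 -> ~ right_null.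
Proof.
move=> p0 q0 t0 [v v0 vn]; have [v1 [v2 [v3 Ev]]] := basis3P v B.
(* (e2, e3, v) = - 2 t v1 e1 - q v3 e2 + p v2 e3. *)
have := vn (lc3 e1 e2 e3 0 1 0) (lc3 e1 e2 e3 0 0 1).
rewrite Ev op -(lc3_000 e1 e2 e3) => /(lc3_inj F)[H1 H2 H3].
have Ev1 : v1 = 0 by apply: (mulfI t0); lra.
have Ev2 : v2 = 0 by apply: (mulfI p0); lra.
have Ev3 : v3 = 0 by apply: (mulfI q0); lra.
by move: v0; rewrite Ev Ev1 Ev2 Ev3 lc3_000 eqxx.
Qed.

Lemma self_eigen_std1 : self_eigen p.
Proof.
exists e2, e3 => //; have [-> _] := std23 T.
by rewrite /lc2 oppr0 scale0r add0r.
Qed.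

Lemma self_eigen_std2 : self_eigen q.
Proof.
exists e3, e2 => //; have [_ E] := std23 T.
by rewrite lts_antisym E /lc2 scale0r addr0 scaleNr opprK.
Qed.

(** Modulo e1 the equation reads (y2, y3) = m (x3, - x2) with m = x2 y3 - x3 y2, so m (1 + x2^2 +
    x3^2) = 0 and y2 = y3 = 0. The e1-coordinate then gives (1 + x2^2 + x3^2) y1 = 0. *)
Lemma not_self_eigen_std eps : eps != 0 -> p = - eps -> q = - eps ->
  s = -1 -> t = 0 -> ~ self_eigen eps.
Proof.
move=> eps0 Ep Eq Es Et [x [y y0]].
have [x1 [x2 [x3 ->]]] := basis3P x B; have [y1 [y2 [y3 Ey]]] := basis3P y B.
rewrite Ey op lc3Z Ep Eq Es Et => /(lc3_inj F)[H1 H2 H3].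
have [m Em] : exists m, m = x2 * y3 - x3 * y2 by exists (x2 * y3 - x3 * y2).
have {}H2 : y2 = m * x3 by apply: (mulfI eps0); rewrite -H2 Em; ring.
have {}H3 : y3 = - m * x2 by apply: (mulfI eps0); rewrite -H3 Em; ring.
have {}H1 : (1 + x2 ^+ 2 + x3 ^+ 2) * y1 = x1 * (x2 * y2 + x3 * y3).
  by apply: (mulfI eps0); lra.
have pos : 1 + x2 ^+ 2 + x3 ^+ 2 != 0.
  by rewrite gt_eqF // -addrA ltr_wpDr // addr_ge0 ?sqr_ge0.
have m0 : m = 0.
  by rewrite H2 H3 in Em; apply: (mulfI pos); lra.
have Ey2 : y2 = 0 by rewrite H2 m0 mul0r.
have Ey3 : y3 = 0 by rewrite H3 m0 oppr0 mul0r.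
have Ey1 : y1 = 0 by apply: (mulfI pos); rewrite H1 Ey2 Ey3 !mulr0 addr0 mulr0.
by move: y0; rewrite Ey Ey1 Ey2 Ey3 lc3_000 eqxx.
Qed.

End Invariants.

(** * Invariance under isomorphism *)

Section IsoInvariants.
Variables (R : realType) (V W : vectType R) (M : lts V) (N : lts W).
Hypothesis MN : lts_iso M N.

Let inj_iso : exists2 f : 'Hom(V, W), (forall x, (f x == 0) = (x == 0)) &
  (forall y, exists x, y = f x) /\ forall x y z, f (M x y z) = N (f x) (f y) (f z).
Proof.
have [f [[g fK gK] fM]] := MN; exists f => [x|].
  by rewrite -(inj_eq (can_inj fK)) linear0.
by split=> // y; exists (g y); rewrite gK.
Qed.

Lemma iso_left_null : left_null M -> left_null N.
Proof.
have [f f0 [fS fM]] := inj_iso; case=> v v0 vn.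
exists (f v) => [|x y]; first by rewrite f0.
by have [[x' ->] [y' ->]] := (fS x, fS y); rewrite -fM vn linear0.
Qed.

Lemma iso_right_null : right_null M -> right_null N.
Proof.
have [f f0 [fS fM]] := inj_iso; case=> v v0 vn.
exists (f v) => [|x y]; first by rewrite f0.
by have [[x' ->] [y' ->]] := (fS x, fS y); rewrite -fM vn linear0.
Qed.

Lemma iso_self_eigen eps : self_eigen M eps -> self_eigen N eps.
Proof.
have [f f0 [_ fM]] := inj_iso; case=> x [y y0 E].
by exists (f x), (f y); rewrite ?f0 // -fM E linearZ.
Qed.

End IsoInvariants.

(** * Separation of the types and the classification *)

(** Each clause transports one invariant from [M] to [N]. In the third, eps is a diagonal entry for
    [M], hence satisfies [self_eigen], which fails for diag(- eps, - eps) with s' = -1 and t' =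
    0. *)
Lemma std_iso_invariants (R : realType) (V W : vectType R) (M : lts V) (N : lts W)
    e1 e2 e3 p q s t e1' e2' e3' p' q' s' t' :
  basis_of fullv [:: e1; e2; e3] -> std_table M e1 e2 e3 p q s t ->
  basis_of fullv [:: e1'; e2'; e3'] -> std_table N e1' e2' e3' p' q' s' t' ->
  p' != 0 -> q' != 0 -> lts_iso M N ->
  [/\ s = 0 -> t = 0 -> s' = 0, t = 0 -> t' = 0 &
      forall eps, eps != 0 -> p = eps \/ q = eps ->
        p' = - eps -> q' = - eps -> s' = -1 -> t' <> 0].
Proof.
move=> B T B' T' p0 q0 MN; split=> [s0 t0|t0|eps eps0 pq Ep Eq Es Et].
- have [//|/(not_left_null_std B' T' p0 q0)[]] := eqVneq s' 0.
  exact/(iso_left_null MN)/(left_null_std B T).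
- have [//|/(not_right_null_std B' T' p0 q0)[]] := eqVneq t' 0.
  exact/(iso_right_null MN)/(right_null_std B T).
apply: (not_self_eigen_std B' T' eps0 Ep Eq Es Et); apply: (iso_self_eigen MN).
by case: pq => <-; [exact: self_eigen_std1 B T | exact: self_eigen_std2 B T].
Qed.

Lemma type_iso_eq (R : realType) (V W : vectType R) (M : lts V) (N : lts W)
    (M1 M2 : {vspace V}) (N1 N2 : {vspace W}) k l :
  splitting M M1 M2 -> splitting N N1 N2 ->
  has_type M k M1 M2 -> has_type N l N1 N2 -> lts_iso M N ->
  [\/ k = l, k = Ty5 /\ l = Ty6 | k = Ty6 /\ l = Ty5].
Proof.
move=> sM sN /(has_typeP k sM)[f [s [t [e1 [e2 [e3 [K [B _ _ T]]]]]]]].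
move=> /(has_typeP l sN)[f' [s' [t' [e1' [e2' [e3' [K' [B' _ _ T']]]]]]]] MN.
(* The invariants are compared in both directions, with eps = 1 and eps = -1. *)
have [I1 I2 /[dup] Ip /(_ (-1)) In] :=
  std_iso_invariants B T B' T' (diag1_neq0 R f') (diag2_neq0 R f') MN.
have [J1 J2 /[dup] Jp /(_ (-1)) Jn] :=
  std_iso_invariants B' T' B T (diag1_neq0 R f) (diag2_neq0 R f) (lts_iso_sym MN).
move: {Ip}(Ip 1) {Jp}(Jp 1) => {B T B' T' MN} Ip Jp.
have n1 := oner_neq0 R; have n1' : -1 != 0 :> R by rewrite oppr_eq0.
have F1 : -1 <> 0 :> R by apply/eqP.
have F2 : - 4^-1 <> 0 :> R by lra.
have F3 : 4^-1 <> 0 :> R by lra.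
have NN : - (-1) = 1 :> R by rewrite opprK.
(* All pairs of types are inspected: equal ones and the pairs 5, 6 are allowed conclusions, and
   every other pair violates one of the transported implications. *)
case: k K => /= -[]; do ?[move=> ->]; case: l K' => /= -[]; intros; subst;
  try (by constructor).
all: rewrite /= in I1 I2 Ip In J1 J2 Jp Jn; exfalso.
all: by [move: (I1 erefl erefl) | move: (J1 erefl erefl) | move: (I2 erefl)
  | move: (J2 erefl) | apply: Ip; auto | apply: In; auto | apply: Jp; auto
  | apply: Jn; auto].
Qed.

Theorem theorem5p1 (R : realType) :
  [/\ (* the listed situations are the possible ones *)
      forall (V : vectType R) (M : lts V) (M1 M2 : {vspace V}),
        splitting M M1 M2 -> exists k : splitType, has_type M k M1 M2,
      (* each of them occurs, Type 1 with each of the three forms of M2 *)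
      forall k : splitType,
        exists (V : vectType R) (M : lts V) (M1 M2 : {vspace V}),
          splitting M M1 M2 /\ has_type M k M1 M2,
      forall f : form2,
        exists (V : vectType R) (M : lts V) (M1 M2 : {vspace V}),
          [/\ splitting M M1 M2, has_type M Ty1 M1 M2 & of_form2 M f M2],
      (* systems of different types are non-isomorphic, Types 5 and 6
         (which coincide up to e3 |-> - e3, see has_type56) excepted *)
      forall (V W : vectType R) (M : lts V) (N : lts W)
             (M1 M2 : {vspace V}) (N1 N2 : {vspace W}) (k l : splitType),
        splitting M M1 M2 -> splitting N N1 N2 ->
        has_type M k M1 M2 -> has_type N l N1 N2 ->
        k <> l -> ~ (k = Ty5 /\ l = Ty6) -> ~ (k = Ty6 /\ l = Ty5) ->
        ~ lts_iso M N
    & (* any system of Type 5 is isomorphic to any system of Type 6 *)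
      forall (V W : vectType R) (M : lts V) (N : lts W)
             (M1 M2 : {vspace V}) (N1 N2 : {vspace W}),
        splitting M M1 M2 -> splitting N N1 N2 ->
        has_type M Ty5 M1 M2 -> has_type N Ty6 N1 N2 ->
        lts_iso M N].
Proof.
have occurs k f (s t : R) : type_params k f s t ->
    exists (V : vectType R) (M : lts V) (M1 M2 : {vspace V}),
      [/\ splitting M M1 M2, has_type M k M1 M2 & of_form2 M f M2].
  move=> K; have [ht hs] := type_params_constraints K.
  have [M1 [M2 [e1 [e2 [e3 A]]]]] := std_lts_adapted ht hs.
  have sM := adapted_splitting A (diag1_neq0 R f) (diag2_neq0 R f).
  exists _, (std_lts ht hs), M1, M2; split=> //; last exact: adapted_of_form2 A.
  by apply/has_typeP => //; exists f, s, t, e1, e2, e3.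
split.
- move=> V M M1 M2 sM.
  have [f [s [t [e1 [e2 [e3 A]]]]]] := splitting_adapted_form sM; have [B _ _ T] := A.
  have [ht hs] := std_constraints B T (diag1_neq0 R f).
  have [k K] := type_params_exhaust ht hs; exists k.
  by apply/has_typeP => //; exists f, s, t, e1, e2, e3.
- move=> k; have [f [s [t K]]] : exists f (s t : R), type_params k f s t.
    case: k; [exists SO3_SO2, 0, 0|exists SO3_SO2, (-1), 0|exists SL2_SO2, (-1), 0|
      exists SL2_R, (-1), 0|exists SL2_R, (- 4^-1), 4^-1|exists SL2_R, (- 4^-1), (- 4^-1)];
      by split.
  have [V [M [M1 [M2 [sM kM _]]]]] := occurs _ _ _ _ K.
  by exists V, M, M1, M2.
- by move=> f; apply: (occurs Ty1 f 0 0).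
- move=> V W M N M1 M2 N1 N2 k l sM sN kM lN kl n56 n65 MN.
  by case: (type_iso_eq sM sN kM lN MN).
(* By [has_type56] the second system is also of Type 5, so both have adapted bases with p = 1, q =
   -1, s = -1/4, t = 1/4. *)
move=> V W M N M1 M2 N1 N2 sM sN /(has_typeP Ty5 sM) + /has_type56/(has_typeP Ty5 sN).
case=> [_ [_ [_ [e1 [e2 [e3 [[-> -> ->] A]]]]]]].
by case=> [_ [_ [_ [e1' [e2' [e3' [[-> -> ->] /(adapted_iso A)]]]]]]].
Qed.
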